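(* Let $n\ge 1$ be an integer, $0<\alpha\le 1$, $0\le a<b\le\infty$, $t_0\in(a,b)$, and $y_0,y_1,\dots,y_{n-1}\in\mathbb{R}$. Let $p_0,p_1,\dots,p_{n-1},q:(a,b)\to\mathbb{R}$ be functions such that $t^{\alpha-1}p_{n-1}(t),\dots,t^{\alpha-1}p_1(t),t^{\alpha-1}p_0(t),t^{\alpha-1}q(t)$ are continuous on $(a,b)$. Then the initial value problem $${}^nT_\alpha y+p_{n-1}(t)\,{}^{n-1}T_\alpha y+\cdots+p_2(t)\,{}^2T_\alpha y+p_1(t)\,T_\alpha y+p_0(t)\,y=q(t)\quad(t\in(a,b)),$$ $$y(t_0)=y_0,\quad T_\alpha y(t_0)=y_1,\quad\dots,\quad {}^{n-1}T_\alpha y(t_0)=y_{n-1},$$ has a solution $y$ on the interval $(a,b)$, and this solution is unique. Here a solution is an $n$ times $\alpha$-differentiable function $y:(a,b)\to\mathbb{R}$ satisfying the equation at every point of $(a,b)$ together with the initial conditions.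
   Context: For $0<\alpha\le 1$ and a real-valued function $f$ defined on an interval $(a,b)\subseteq(0,\infty)$, the conformable fractional derivative of $f$ of order $\alpha$ at $t\in(a,b)$ is $$T_\alpha f(t)=\lim_{\varepsilon\to 0}\frac{f(t+\varepsilon t^{1-\alpha})-f(t)}{\varepsilon},$$ whenever this limit exists (as a real number). $f$ is $\alpha$-differentiable on $(a,b)$ if the limit exists at every $t\in(a,b)$. The sequential derivative ${}^kT_\alpha f=T_\alpha T_\alpha\cdots T_\alpha f$ is the $k$-fold iterate of $T_\alpha$ (with ${}^0T_\alpha f=f$, ${}^1T_\alpha f=T_\alpha f$), and $f$ is $n$ times $\alpha$-differentiable on $(a,b)$ if ${}^1T_\alpha f,\dots,{}^nT_\alpha f$ all exist on $(a,b)$. *)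

(* Defs.v *)
From Stdlib Require Import Reals.
From Coquelicot Require Import Coquelicot.
Open Scope R_scope.

(* Functions on (a,b) are represented by total functions R -> R. Their values
   outside (a,b) are irrelevant: (a,b) is open, so every limit below at a point
   of (a,b) depends only on values inside (a,b). *)

Definition open_itv (a : R) (b : Rbar) (t : R) : Prop :=
  a < t /\ Rbar_lt t b.

Definition conf_quot (alpha : R) (f : R -> R) (t eps : R) : R :=
  (f (t + eps * Rpower t (1 - alpha)) - f t) / eps.

(* Only meaningful at points where [ex_conf_deriv] holds. *)
Definition conf_deriv (alpha : R) (f : R -> R) (t : R) : R :=
  real (Lim (conf_quot alpha f t) 0).

Definition ex_conf_deriv (alpha : R) (f : R -> R) (t : R) : Prop :=
  ex_finite_lim (conf_quot alpha f t) 0.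

Definition conf_differentiable (alpha a : R) (b : Rbar) (f : R -> R) : Prop :=
  forall t : R, open_itv a b t -> ex_conf_deriv alpha f t.

Definition conf_deriv_n (alpha : R) (k : nat) (f : R -> R) : R -> R :=
  Nat.iter k (conf_deriv alpha) f.

Definition conf_differentiable_n
    (alpha a : R) (b : Rbar) (n : nat) (f : R -> R) : Prop :=
  forall k : nat, (k < n)%nat ->
    conf_differentiable alpha a b (conf_deriv_n alpha k f).

(* [sum_f_R0 u (n - 1)] is u 0 + ... + u (n - 1); it is used for n >= 1 only. *)
Definition is_ivp_solution (n : nat) (alpha a : R) (b : Rbar) (t0 : R)
    (p : nat -> R -> R) (q : R -> R) (y0 : nat -> R) (y : R -> R) : Prop :=
  conf_differentiable_n alpha a b n y /\
  (forall t : R, open_itv a b t ->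
     conf_deriv_n alpha n y t
       + sum_f_R0 (fun k => p k t * conf_deriv_n alpha k y t) (n - 1) = q t) /\
  (forall k : nat, (k < n)%nat -> conf_deriv_n alpha k y t0 = y0 k).

(* Main.v *)
(** Since T_alpha f = t^(1-alpha) f' at every t > 0, the equation is a linear first
    order system Y' = F(t, Y) on (a,b) whose Lipschitz constant L(t) is continuous,
    hence bounded on every segment [c,d] containing t0. If M bounds L on [c,d], the
    Picard operator halves distances in the norm weighted by exp(-2 M |t - t0|). The
    Picard iterates are defined on all of (a,b) and so is their pointwise limit, so
    that the estimates on segments need no gluing of local solutions; the same
    contraction gives uniqueness. *)

Require Import Defs.
From Stdlib Require Import Reals Lra Lia.
From Coquelicot Require Import Coquelicot.
Open Scope R_scope.

(** * Segments inside (a,b) *)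

Lemma open_itv_convex (a : R) (b : Rbar) (s t u : R) :
  open_itv a b s -> open_itv a b t -> Rmin s t <= u <= Rmax s t -> open_itv a b u.
Proof.
  unfold open_itv, Rmin, Rmax; intros [Hs Hs'] [Ht Ht'].
  destruct (Rle_dec s t); intros Hu; (split; [lra |]);
    destruct b; simpl in *; trivial; lra.
Qed.

Lemma open_open_itv (a : R) (b : Rbar) : open (open_itv a b).
Proof. apply open_and; [apply open_gt | apply open_Rbar_lt]. Qed.

(** Openness leaves room beyond both points, so they can be placed strictly inside a compact
    segment, also when [b] is infinite. Compactness serves to bound continuous functions, strictness
    to argue on the open interval (c,d) around [t]. *)
Lemma open_itv_segment (a : R) (b : Rbar) (s t : R) :
  open_itv a b s -> open_itv a b t ->
  exists c d, c < s < d /\ c < t < d /\ forall u, c <= u <= d -> open_itv a b u.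
Proof.
  intros Hs Ht.
  destruct (open_open_itv a b _ Hs) as [es Hes].
  destruct (open_open_itv a b _ Ht) as [et Het].
  pose proof (cond_pos es); pose proof (cond_pos et).
  assert (Bs : forall u, Rabs (u - s) < es -> open_itv a b u) by exact Hes.
  assert (Bt : forall u, Rabs (u - t) < et -> open_itv a b u) by exact Het.
  set (c := Rmin (s - es / 2) (t - et / 2)); set (d := Rmax (s + es / 2) (t + et / 2)).
  assert (Hc : open_itv a b c).
  (* Whichever term attains the minimum lies half a radius from its own centre, hence in the
     interval. *)
  { unfold c, Rmin; destruct Rle_dec; [apply Bs | apply Bt]; apply Rabs_def1; lra. }
  assert (Hd : open_itv a b d).
  { unfold d, Rmax; destruct Rle_dec; [apply Bt | apply Bs]; apply Rabs_def1; lra. }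
  pose proof (Rmin_l (s - es / 2) (t - et / 2)) as H1.
  pose proof (Rmin_r (s - es / 2) (t - et / 2)) as H2.
  pose proof (Rmax_l (s + es / 2) (t + et / 2)) as H3.
  pose proof (Rmax_r (s + es / 2) (t + et / 2)) as H4.
  fold c in H1, H2; fold d in H3, H4.
  exists c, d; split; [lra | split; [lra |]].
  intros u Hu; apply (open_itv_convex a b c d); trivial.
  now rewrite Rmin_left, Rmax_right by lra.
Qed.

(** * The conformable derivative in terms of the ordinary one *)

Lemma is_derive_continuous (f : R -> R) (t l : R) : is_derive f t l -> continuous f t.
Proof. intros H; apply (ex_derive_continuous (V := R_NormedModule)); now exists l. Qed.

Lemma is_lim_scale (g : R -> R) (c l : R) :
  c <> 0 -> is_lim g 0 l -> is_lim (fun x => g (c * x)) 0 l.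
Proof.
  intros Hc Hg.
  apply is_lim_comp with (l := 0); trivial.
  - pose proof (is_lim_scal_l _ c 0 0 (is_lim_id 0)) as H.
    simpl in H; now rewrite Rmult_0_r in H.
  (* Limits at 0 are punctured: composition requires [c * x] to avoid 0 for [x <> 0]. *)
  - exists (mkposreal 1 Rlt_0_1); intros x _ Hx E; apply Hx.
    injection E; intros E'; destruct (Rmult_integral _ _ E'); tauto.
Qed.

Lemma is_derive_is_lim (f : R -> R) (t l : R) :
  is_derive f t l <-> is_lim (fun h => (f (t + h) - f t) / h) 0 l.
Proof.
  rewrite is_derive_Reals, <- is_lim_spec; split; intros H eps.
  - destruct (H eps (cond_pos eps)) as [d Hd]; exists d; intros h Hh Hh0.
    apply Hd; trivial.
    change (Rabs (h - 0) < d) in Hh; now rewrite Rminus_0_r in Hh.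
  - intros Heps; destruct (H (mkposreal eps Heps)) as [d Hd]; exists d; intros h Hh0 Hh.
    apply Hd; trivial.
    change (Rabs (h - 0) < d); now rewrite Rminus_0_r.
Qed.

(** The substitution h = eps * t^(1-alpha), with a positive factor, carries one difference quotient
    into a multiple of the other. This is T_alpha f = t^(1-alpha) f', solved for f' so that it can
    feed an ordinary differential system. *)
Lemma is_lim_conf_quot (alpha : R) (f : R -> R) (t l : R) :
  is_lim (conf_quot alpha f t) 0 l <-> is_derive f t (Rpower t (alpha - 1) * l).
Proof.
  assert (Er : Rpower t (alpha - 1) = / Rpower t (1 - alpha)).
  { rewrite <- Rpower_Ropp; f_equal; lra. }
  rewrite Er, is_derive_is_lim.
  assert (Hr : 0 < Rpower t (1 - alpha)) by apply exp_pos.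
  unfold conf_quot.
  set (r := Rpower t (1 - alpha)) in *; split; intros H.
  - apply is_lim_ext_loc with
      (fun h => / r * ((f (t + (/ r * h) * r) - f t) / (/ r * h))).
    + exists (mkposreal 1 Rlt_0_1); intros h _ Hh.
      replace (t + / r * h * r) with (t + h) by (field; lra).
      field; split; lra.
    + apply (is_lim_scal_l _ (/ r) 0 l).
      apply (is_lim_scale (fun e => (f (t + e * r) - f t) / e)); trivial.
      apply Rinv_neq_0_compat; lra.
  - apply is_lim_ext_loc with (fun e => r * ((f (t + r * e) - f t) / (r * e))).
    + exists (mkposreal 1 Rlt_0_1); intros h _ Hh.
      rewrite (Rmult_comm h r); field; split; lra.
    + replace (Finite l) with (Rbar_mult r (/ r * l)) by (simpl; f_equal; field; lra).
      apply is_lim_scal_l.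
      apply (is_lim_scale (fun h => (f (t + h) - f t) / h)); trivial; lra.
Qed.

Lemma ex_conf_deriv_is_derive (alpha : R) (f : R -> R) (t : R) :
  ex_conf_deriv alpha f t ->
  is_derive f t (Rpower t (alpha - 1) * conf_deriv alpha f t).
Proof.
  intros [l Hl]; apply is_lim_conf_quot; unfold conf_deriv.
  now rewrite (is_lim_unique _ _ _ Hl).
Qed.

Lemma is_derive_conf_deriv (alpha : R) (f : R -> R) (t l : R) :
  is_derive f t (Rpower t (alpha - 1) * l) ->
  ex_conf_deriv alpha f t /\ conf_deriv alpha f t = l.
Proof.
  intros H; apply is_lim_conf_quot in H; split.
  - now exists l.
  - unfold conf_deriv; now rewrite (is_lim_unique _ _ _ H).
Qed.

(** * Primitives and exponentially weighted estimates *)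

Lemma is_derive_primitive (a : R) (b : Rbar) (g : R -> R) (t0 t y : R) :
  (forall s, open_itv a b s -> continuous g s) ->
  open_itv a b t0 -> open_itv a b t ->
  is_derive (fun u => y + RInt g t0 u) t (g t).
Proof.
  intros Hg H0 Ht.
  replace (g t) with (0 + g t) by ring.
  apply (is_derive_plus (fun _ => y) (fun u => RInt g t0 u) t 0 (g t)).
  - apply (is_derive_const (K := R_AbsRing) (V := R_NormedModule)).
  - apply (is_derive_RInt g _ t0 t); [| now apply Hg].
    (* Integrability is required up to every [u] near [t]; convexity keeps the whole path from [t0]
       to [u] in (a,b), where [g] is continuous. *)
    generalize (open_open_itv a b t Ht); apply filter_imp; intros u Hu.
    apply (RInt_correct (V := R_CompleteNormedModule) g t0 u), ex_RInt_continuous.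
    intros z Hz; apply Hg; exact (open_itv_convex _ _ _ _ _ H0 Hu Hz).
Qed.

Lemma exp_le (x y : R) : x <= y -> exp x <= exp y.
Proof. intros [H | ->]; [left; now apply exp_increasing | apply Rle_refl]. Qed.

(** The majorant C/2 * exp(2L(s-t0)) has derivative exactly L*C*exp(2L(s-t0)), so its difference
    with [g] is nondecreasing from the value C/2 >= 0 at [t0]. The factor 2 in the exponent is what
    produces the half. *)
Lemma exp_weight_bound_right (g dg : R -> R) (t0 t L C : R) :
  t0 <= t ->
  (forall s, t0 <= s <= t -> is_derive g s (dg s)) ->
  (forall s, t0 <= s <= t -> dg s <= L * C * exp (2 * L * (s - t0))) ->
  0 <= C -> g t0 = 0 -> g t <= C / 2 * exp (2 * L * (t - t0)).
Proof.
  intros Ht Hg Hdg HC Hg0.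
  assert (Hh : forall s, t0 <= s <= t ->
    is_derive (fun s => C / 2 * exp (2 * L * (s - t0)) - g s) s
      (L * C * exp (2 * L * (s - t0)) - dg s)).
  { intros s Hs; apply (is_derive_minus (fun s => C / 2 * exp (2 * L * (s - t0))) g).
    - auto_derive; trivial; unfold Rminus; field.
    - now apply Hg. }
  destruct (MVT_gen (fun s => C / 2 * exp (2 * L * (s - t0)) - g s) t0 t
    (fun s => L * C * exp (2 * L * (s - t0)) - dg s)) as [c [Hc E]].
  - rewrite Rmin_left, Rmax_right by trivial; intros; apply Hh; lra.
  - rewrite Rmin_left, Rmax_right by trivial; intros s Hs; apply continuity_pt_filterlim.
    exact (is_derive_continuous _ _ _ (Hh s Hs)).
  - rewrite Rmin_left, Rmax_right in Hc by trivial.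
    specialize (Hdg c Hc).
    rewrite Hg0, Rminus_diag, Rmult_0_r, exp_0 in E.
    assert (0 <= (L * C * exp (2 * L * (c - t0)) - dg c) * (t - t0))
      by (apply Rmult_le_pos; lra).
    lra.
Qed.

(** The one-sided estimate is applied to [g] and [- g], and for t < t0 to their reflections about
    [t0]. *)
Lemma exp_weight_bound (g dg : R -> R) (t0 t L C : R) :
  (forall s, Rmin t0 t <= s <= Rmax t0 t -> is_derive g s (dg s)) ->
  (forall s, Rmin t0 t <= s <= Rmax t0 t ->
     Rabs (dg s) <= L * C * exp (2 * L * Rabs (s - t0))) ->
  0 <= C -> g t0 = 0 -> Rabs (g t) <= C / 2 * exp (2 * L * Rabs (t - t0)).
Proof.
  intros Hg Hdg HC Hg0.
  destruct (Rle_dec t0 t) as [Ht | Ht].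
  - rewrite Rmin_left, Rmax_right in Hg, Hdg by trivial.
    assert (Hdg' : forall s, t0 <= s <= t ->
      - (L * C * exp (2 * L * (s - t0))) <= dg s <= L * C * exp (2 * L * (s - t0))).
    { intros s Hs; specialize (Hdg s Hs).
      rewrite (Rabs_pos_eq (s - t0)) in Hdg by lra; now apply Rabs_le_between. }
    rewrite (Rabs_pos_eq (t - t0)) by lra.
    apply Rabs_le; split.
    + apply Ropp_le_cancel; rewrite Ropp_involutive.
      apply (exp_weight_bound_right (fun s => - g s) (fun s => - dg s)); trivial.
      * intros s Hs; apply (is_derive_opp g); auto.
      * intros s Hs; specialize (Hdg' s Hs); lra.
      * lra.
    + apply (exp_weight_bound_right g dg); trivial.
      intros s Hs; apply Hdg'; trivial.
  - assert (Ht' : t <= t0) by lra.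
    rewrite Rmin_right, Rmax_left in Hg, Hdg by trivial.
    assert (Hdg' : forall s, t <= s <= t0 ->
      - (L * C * exp (2 * L * (t0 - s))) <= dg s <= L * C * exp (2 * L * (t0 - s))).
    { intros s Hs; specialize (Hdg s Hs).
      rewrite (Rabs_minus_sym s t0), (Rabs_pos_eq (t0 - s)) in Hdg by lra.
      now apply Rabs_le_between. }
    (* The reflection s -> 2 t0 - s exchanges [t,t0] with [t0, 2 t0 - t] and fixes [t0]. *)
    assert (Hr : forall s, t0 <= s <= 2 * t0 - t ->
      is_derive (fun s => g (2 * t0 - s)) s (- dg (2 * t0 - s))).
    { intros s Hs.
      replace (- dg (2 * t0 - s)) with (scal (-1) (dg (2 * t0 - s)))
        by (change (-1 * dg (2 * t0 - s) = - dg (2 * t0 - s)); ring).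
      apply (is_derive_comp g (fun s => 2 * t0 - s)).
      - apply Hg; lra.
      - auto_derive; trivial; ring. }
    rewrite (Rabs_minus_sym t t0), (Rabs_pos_eq (t0 - t)) by lra.
    replace (g t) with (g (2 * t0 - (2 * t0 - t))) by (f_equal; ring).
    replace (t0 - t) with (2 * t0 - t - t0) by ring.
    assert (H0 : g (2 * t0 - t0) = 0) by (rewrite <- Hg0; f_equal; ring).
    apply Rabs_le; split.
    + apply Ropp_le_cancel; rewrite Ropp_involutive.
      apply (exp_weight_bound_right (fun s => - g (2 * t0 - s))
        (fun s => dg (2 * t0 - s))); trivial; try lra.
      * intros s Hs.
        rewrite <- (Ropp_involutive (dg (2 * t0 - s))).
        apply (is_derive_opp (fun s => g (2 * t0 - s))); auto.
      * intros s Hs; replace (s - t0) with (t0 - (2 * t0 - s)) by ring.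
        apply Hdg'; lra.
    + apply (exp_weight_bound_right (fun s => g (2 * t0 - s))
        (fun s => - dg (2 * t0 - s))); trivial; try lra.
      intros s Hs; replace (s - t0) with (t0 - (2 * t0 - s)) by ring.
      specialize (Hdg' (2 * t0 - s)); lra.
Qed.

(** * Geometric convergence and bounds on segments *)

(** The tail of the majorizing series from index m is 2K/2^m. Subtracting it from [u] gives an
    increasing sequence, adding it a decreasing one; both have the same limit, which yields
    convergence and the error bound together. *)
Lemma geometric_increments (u : nat -> R) (K : R) :
  (forall m, Rabs (u (S m) - u m) <= K * (/ 2) ^ m) ->
  ex_finite_lim_seq u /\
  forall m, Rabs (u m - real (Lim_seq u)) <= 2 * K * (/ 2) ^ m.
Proof.
  intros Hu.
  assert (Hd : forall m, - (K * (/ 2) ^ m) <= u (S m) - u m <= K * (/ 2) ^ m)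
    by (intros m; apply Rabs_le_between, Hu).
  assert (HK : 0 <= K).
  { specialize (Hu 0%nat); simpl in Hu; pose proof (Rabs_pos (u 1%nat - u 0%nat)); lra. }
  set (v := fun m => u m - 2 * K * (/ 2) ^ m).
  set (w := fun m => u m + 2 * K * (/ 2) ^ m).
  assert (Hv : forall m, v m <= v (S m)).
  { intros m; unfold v; specialize (Hd m); simpl; lra. }
  assert (Hw : forall m, w (S m) <= w m).
  { intros m; unfold w; specialize (Hd m); simpl; lra. }
  assert (Hvw : forall m, v m <= w m).
  { intros m; unfold v, w.
    assert (0 <= K * (/ 2) ^ m) by (apply Rmult_le_pos; [trivial | apply pow_le; lra]).
    lra. }
  assert (Hw0 : forall m, w m <= w 0%nat).
  { induction m; [lra | specialize (Hw m); lra]. }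
  destruct (ex_finite_lim_seq_incr v (w 0%nat)) as [l Hl]; trivial.
  { intros m; specialize (Hw0 m); specialize (Hvw m); lra. }
  assert (Hgeo : is_lim_seq (fun m => 2 * K * (/ 2) ^ m) 0).
  { replace (Finite 0) with (Rbar_mult (2 * K) 0) by (simpl; now rewrite Rmult_0_r).
    apply is_lim_seq_scal_l, is_lim_seq_geom; rewrite Rabs_pos_eq; lra. }
  assert (Hlu : is_lim_seq u l).
  { apply is_lim_seq_ext with (fun m => v m + 2 * K * (/ 2) ^ m).
    - intros m; unfold v; ring.
    - replace l with (l + 0) by ring; now apply is_lim_seq_plus'. }
  assert (Hlw : is_lim_seq w l).
  { replace l with (l + 0) by ring; now apply is_lim_seq_plus'. }
  split; [now exists l | intros m].
  rewrite (is_lim_seq_unique _ _ Hlu); simpl.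
  pose proof (is_lim_seq_incr_compare v l Hl Hv m) as H1.
  pose proof (is_lim_seq_decr_compare w l Hlw Hw m) as H2.
  unfold v in H1; unfold w in H2; apply Rabs_le; lra.
Qed.

Lemma finite_family_bound (n : nat) (g : nat -> R -> R) (c d : R) :
  (forall k s, (k < n)%nat -> c <= s <= d -> continuous (g k) s) ->
  exists C, 0 <= C /\ forall k s, (k < n)%nat -> c <= s <= d -> Rabs (g k s) <= C.
Proof.
  induction n as [| n IH]; intros Hg.
  - exists 0; split; [lra | intros; lia].
  - destruct IH as [C [HC IH]]; [intros; apply Hg; trivial; lia |].
    destruct (bounded_continuity (K := R_AbsRing) (V := R_NormedModule) (g n) c d)
      as [M HM]; [intros; apply Hg; trivial; lia |].
    exists (Rmax C M); split; [apply Rle_trans with C; trivial; apply Rmax_l |].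
    intros k s Hk Hs; destruct (Nat.eq_dec k n) as [-> | Hn].
    + apply Rle_trans with M; [left; now apply HM | apply Rmax_r].
    + apply Rle_trans with C; [apply IH; trivial; lia | apply Rmax_l].
Qed.

(** Turns a contraction estimate iterated arbitrarily often into an equality. *)
Lemma le_geometric_eq (x y K : R) :
  (forall m, Rabs (x - y) <= K * (/ 2) ^ m) -> x = y.
Proof.
  intros H.
  assert (Hgeo : is_lim_seq (fun m => K * (/ 2) ^ m) 0).
  { replace (Finite 0) with (Rbar_mult K 0) by (simpl; now rewrite Rmult_0_r).
    apply is_lim_seq_scal_l, is_lim_seq_geom; rewrite Rabs_pos_eq; lra. }
  pose proof (is_lim_seq_le _ _ (Rabs (x - y)) 0 H (is_lim_seq_const _) Hgeo) as Hle.
  simpl in Hle; pose proof (Rabs_pos (x - y)).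
  apply Rminus_diag_uniq.
  destruct (Req_dec (x - y) 0) as [E | E]; trivial.
  apply Rabs_no_R0 in E; lra.
Qed.

(** * Lipschitz systems and the contraction estimate *)

(* Right-hand side [F k t u] of the first order system Y_k' = F_k(t, Y), k < n,
   with a Lipschitz constant [L t] in the sup norm of the first [n] components. *)
Definition lipschitz_field (n : nat) (a : R) (b : Rbar)
    (F : nat -> R -> (nat -> R) -> R) (L : R -> R) : Prop :=
  (forall (Y : nat -> R -> R) k t, (k < n)%nat -> open_itv a b t ->
     (forall j, (j < n)%nat -> continuous (Y j) t) ->
     continuous (fun s => F k s (fun j => Y j s)) t) /\
  (forall t, open_itv a b t -> continuous L t) /\
  (forall k t u v D, (k < n)%nat -> open_itv a b t -> 0 <= D ->
     (forall j, (j < n)%nat -> Rabs (u j - v j) <= D) ->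
     Rabs (F k t u - F k t v) <= L t * D).

Definition is_system_solution (n : nat) (a : R) (b : Rbar)
    (F : nat -> R -> (nat -> R) -> R) (Y : nat -> R -> R) : Prop :=
  forall k t, (k < n)%nat -> open_itv a b t ->
    is_derive (Y k) t (F k t (fun j => Y j t)).

(* The Picard operator halves distances in the norm weighted by
   [exp (- 2 * M * |s - t0|)] as soon as [M] bounds the Lipschitz constant. *)
Lemma picard_contraction (n : nat) (a : R) (b : Rbar)
    (F : nat -> R -> (nat -> R) -> R) (L : R -> R) (t0 c d M C : R)
    (U V PU PV : nat -> R -> R) :
  lipschitz_field n a b F L ->
  (forall s, c <= s <= d -> open_itv a b s) -> c <= t0 <= d ->
  (forall s, c <= s <= d -> L s <= M) -> 0 <= C ->
  (forall k s, (k < n)%nat -> c <= s <= d ->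
     is_derive (PU k) s (F k s (fun j => U j s))) ->
  (forall k s, (k < n)%nat -> c <= s <= d ->
     is_derive (PV k) s (F k s (fun j => V j s))) ->
  (forall k, (k < n)%nat -> PU k t0 = PV k t0) ->
  (forall k s, (k < n)%nat -> c <= s <= d ->
     Rabs (U k s - V k s) <= C * exp (2 * M * Rabs (s - t0))) ->
  forall k s, (k < n)%nat -> c <= s <= d ->
    Rabs (PU k s - PV k s) <= C / 2 * exp (2 * M * Rabs (s - t0)).
Proof.
  intros (_ & _ & HL) HD H0 HM HC HPU HPV E HUV k t Hk Ht.
  assert (Hs : forall s, Rmin t0 t <= s <= Rmax t0 t -> c <= s <= d).
  { intros s Hs; pose proof (Rmin_glb t0 t c); pose proof (Rmax_lub t0 t d); lra. }
  apply (exp_weight_bound (fun s => PU k s - PV k s)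
    (fun s => F k s (fun j => U j s) - F k s (fun j => V j s))); trivial.
  - intros s Hs1; apply (is_derive_minus (PU k) (PV k)); auto.
  - intros s Hs1; apply Hs in Hs1.
    assert (HW : 0 <= C * exp (2 * M * Rabs (s - t0))).
    { apply Rmult_le_pos; trivial; left; apply exp_pos. }
    (* The Lipschitz condition at the single time [s] is used with the weighted bound itself as [D];
       then [L s <= M]. *)
    apply Rle_trans with (L s * (C * exp (2 * M * Rabs (s - t0)))).
    + apply HL; auto.
    + rewrite (Rmult_assoc M C); apply Rmult_le_compat_r; auto.
  - rewrite E by trivial; ring.
Qed.

Lemma lipschitz_field_bound (n : nat) (a : R) (b : Rbar)
    (F : nat -> R -> (nat -> R) -> R) (L : R -> R) (c d : R) :
  lipschitz_field n a b F L ->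
  (forall s, c <= s <= d -> open_itv a b s) ->
  exists M, 0 <= M /\ forall s, c <= s <= d -> L s <= M.
Proof.
  intros (_ & HL & _) HD.
  destruct (finite_family_bound 1 (fun _ => L) c d) as [M [HM HB]]; auto.
  exists M; split; trivial; intros s Hs.
  apply Rle_trans with (1 := Rle_abs _); apply (HB 0%nat); trivial; lia.
Qed.

(** Lets a plain bound on a segment start an induction on weighted bounds. *)
Lemma one_le_exp_weight (M s : R) : 0 <= M -> 1 <= exp (2 * M * Rabs s).
Proof.
  intros HM; rewrite <- exp_0; apply exp_le.
  pose proof (Rabs_pos s); apply Rmult_le_pos; lra.
Qed.

(** * Uniqueness for systems *)

(** A solution is its own Picard image, so the contraction applies with [Y] and [Z] as both
    arguments and images. Starting from a bound on a compact segment, their distance is halved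
    indefinitely. *)
Lemma system_solution_unique (n : nat) (a : R) (b : Rbar)
    (F : nat -> R -> (nat -> R) -> R) (L : R -> R) (t0 : R) (Y Z : nat -> R -> R) :
  lipschitz_field n a b F L -> open_itv a b t0 ->
  is_system_solution n a b F Y -> is_system_solution n a b F Z ->
  (forall k, (k < n)%nat -> Y k t0 = Z k t0) ->
  forall k t, (k < n)%nat -> open_itv a b t -> Y k t = Z k t.
Proof.
  intros HF H0 HY HZ E k t Hk Ht.
  destruct (open_itv_segment a b t0 t H0 Ht) as (c & d & H0' & Ht' & HD).
  destruct (lipschitz_field_bound n a b F L c d HF HD) as (M & HM & HLM).
  destruct (finite_family_bound n (fun k s => Y k s - Z k s) c d) as (C & HC & HB).
  { intros j s Hj Hs.
    eapply is_derive_continuous; apply (is_derive_minus (Y j) (Z j)); [apply HY | apply HZ]; auto. }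
  assert (HI : forall m k s, (k < n)%nat -> c <= s <= d ->
    Rabs (Y k s - Z k s) <= C * (/ 2) ^ m * exp (2 * M * Rabs (s - t0))).
  { induction m as [| m IH]; intros j s Hj Hs.
    - pose proof (one_le_exp_weight M (s - t0) HM).
      apply Rle_trans with (1 := HB j s Hj Hs); simpl; nra.
    - replace (C * (/ 2) ^ S m) with (C * (/ 2) ^ m / 2) by (simpl; field).
      apply (picard_contraction n a b F L t0 c d M _ Y Z Y Z); auto; try lra.
      apply Rmult_le_pos; trivial; apply pow_le; lra. }
  apply le_geometric_eq with (C * exp (2 * M * Rabs (t - t0))); intros m.
  apply Rle_trans with (1 := HI m k t Hk ltac:(lra)); right; ring.
Qed.

(** * Existence for systems by Picard iteration *)

(** [RInt] is total, so the iterates can be written down before their integrands are known to be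
    continuous on (a,b). *)
Fixpoint picard (F : nat -> R -> (nat -> R) -> R) (t0 : R) (y0 : nat -> R)
    (m : nat) : nat -> R -> R :=
  match m with
  | O => fun k _ => y0 k
  | S m => fun k t => y0 k + RInt (fun s => F k s (fun j => picard F t0 y0 m j s)) t0 t
  end.

(** The two claims go together: continuity of iterate m makes the next integrand continuous, so
    iterate m+1 is differentiable, hence continuous. *)
Lemma is_derive_picard (n : nat) (a : R) (b : Rbar)
    (F : nat -> R -> (nat -> R) -> R) (L : R -> R) (t0 : R) (y0 : nat -> R) (m : nat) :
  lipschitz_field n a b F L -> open_itv a b t0 ->
  forall k t, (k < n)%nat -> open_itv a b t ->
    continuous (picard F t0 y0 m k) t /\
    is_derive (picard F t0 y0 (S m) k) t (F k t (fun j => picard F t0 y0 m j t)).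
Proof.
  intros (HF & _ & _) H0; induction m as [| m IH].
  - intros k t Hk Ht; split; [apply continuous_const |].
    apply (is_derive_primitive a b
      (fun s => F k s (fun j => picard F t0 y0 0 j s))); trivial.
    intros s Hs; apply HF; trivial; intros; apply continuous_const.
  - assert (HC : forall k t, (k < n)%nat -> open_itv a b t ->
      continuous (picard F t0 y0 (S m) k) t).
    { intros k t Hk Ht; eapply is_derive_continuous; apply (IH k t Hk Ht). }
    intros k t Hk Ht; split; auto.
    apply (is_derive_primitive a b
      (fun s => F k s (fun j => picard F t0 y0 (S m) j s))); trivial.
    intros s Hs; apply HF; auto.
Qed.

Lemma picard_init (F : nat -> R -> (nat -> R) -> R) (t0 : R) (y0 : nat -> R) (m k : nat) :
  picard F t0 y0 m k t0 = y0 k.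
Proof.
  destruct m; trivial.
  simpl; rewrite RInt_point; apply Rplus_0_r.
Qed.

(** The first increment is bounded by compactness; every later one compares the Picard images of two
    consecutive iterates, so it is halved. *)
Lemma picard_increment (n : nat) (a : R) (b : Rbar)
    (F : nat -> R -> (nat -> R) -> R) (L : R -> R) (t0 : R) (y0 : nat -> R) (c d M : R) :
  lipschitz_field n a b F L -> open_itv a b t0 ->
  (forall s, c <= s <= d -> open_itv a b s) -> c <= t0 <= d ->
  0 <= M -> (forall s, c <= s <= d -> L s <= M) ->
  exists C, 0 <= C /\ forall m k s, (k < n)%nat -> c <= s <= d ->
    Rabs (picard F t0 y0 (S m) k s - picard F t0 y0 m k s)
      <= C * (/ 2) ^ m * exp (2 * M * Rabs (s - t0)).
Proof.
  intros HF H0 HD H0' HM HLM.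
  destruct (finite_family_bound n
    (fun k s => picard F t0 y0 1 k s - picard F t0 y0 0 k s) c d) as (C & HC & HB).
  { intros j s Hj Hs.
    apply (continuous_minus (V := R_NormedModule)
      (picard F t0 y0 1 j) (picard F t0 y0 0 j));
      eapply is_derive_picard; eauto. }
  exists C; split; trivial.
  induction m as [| m IH]; intros j s Hj Hs.
  - pose proof (one_le_exp_weight M (s - t0) HM).
    apply Rle_trans with (1 := HB j s Hj Hs); simpl pow; nra.
  - replace (C * (/ 2) ^ S m) with (C * (/ 2) ^ m / 2) by (simpl; field).
    apply (picard_contraction n a b F L t0 c d M _
      (picard F t0 y0 (S m)) (picard F t0 y0 m)); auto.
    + apply Rmult_le_pos; trivial; apply pow_le; lra.
    + intros; eapply is_derive_picard; eauto.
    + intros; eapply is_derive_picard; eauto.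
    + intros; now rewrite !picard_init.
Qed.

(** A pointwise limit, chosen independently of any segment. [real] returns the true limit wherever
    the increments are geometric, in particular for components k < n on (a,b). *)
Definition picard_limit (F : nat -> R -> (nat -> R) -> R) (t0 : R) (y0 : nat -> R)
    (k : nat) (t : R) : R :=
  real (Lim_seq (fun m => picard F t0 y0 m k t)).

Lemma picard_limit_bound (n : nat) (a : R) (b : Rbar)
    (F : nat -> R -> (nat -> R) -> R) (L : R -> R) (t0 : R) (y0 : nat -> R) (c d M : R) :
  lipschitz_field n a b F L -> open_itv a b t0 ->
  (forall s, c <= s <= d -> open_itv a b s) -> c <= t0 <= d ->
  0 <= M -> (forall s, c <= s <= d -> L s <= M) ->
  exists C, 0 <= C /\ forall m k s, (k < n)%nat -> c <= s <= d ->
    Rabs (picard F t0 y0 m k s - picard_limit F t0 y0 k s)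
      <= C * (/ 2) ^ m * exp (2 * M * Rabs (s - t0)).
Proof.
  intros HF H0 HD H0' HM HLM.
  destruct (picard_increment n a b F L t0 y0 c d M HF H0 HD H0' HM HLM) as (C & HC & HI).
  exists (2 * C); split; [lra |]; intros m k s Hk Hs.
  (* At a fixed [s] the weight is a constant and joins the factor [K]; summing the tail doubles
     [C]. *)
  destruct (geometric_increments (fun m => picard F t0 y0 m k s)
    (C * exp (2 * M * Rabs (s - t0)))) as [_ HL].
  - intros i; apply Rle_trans with (1 := HI i k s Hk Hs); right; ring.
  - apply Rle_trans with (1 := HL m); right; ring.
Qed.

(** The weighted error bound gives uniform convergence on (c,d), and a uniform limit of continuous
    functions is continuous. *)
Lemma continuous_picard_limit (n : nat) (a : R) (b : Rbar)
    (F : nat -> R -> (nat -> R) -> R) (L : R -> R) (t0 : R) (y0 : nat -> R) :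
  lipschitz_field n a b F L -> open_itv a b t0 ->
  forall k t, (k < n)%nat -> open_itv a b t -> continuous (picard_limit F t0 y0 k) t.
Proof.
  intros HF H0 k t Hk Ht.
  destruct (open_itv_segment a b t0 t H0 Ht) as (c & d & H0' & Ht' & HD).
  destruct (lipschitz_field_bound n a b F L c d HF HD) as (M & HM & HLM).
  destruct (picard_limit_bound n a b F L t0 y0 c d M) as (C & HC & HB);
    trivial; try lra.
  apply continuity_pt_filterlim.
  apply (CVU_cont_open (fun m => picard F t0 y0 m k) (fun s => c < s < d)); trivial.
  - apply open_and; [apply open_gt | apply open_lt].
  - intros eps.
    (* Since |s - t0| <= d - c, the constant exp(2M(d-c)) dominates the weight on the whole
       segment. *)
    assert (Hgeo : is_lim_seq (fun m => C * exp (2 * M * (d - c)) * (/ 2) ^ m) 0).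
    { replace (Finite 0) with (Rbar_mult (C * exp (2 * M * (d - c))) 0)
        by (simpl; now rewrite Rmult_0_r).
      apply is_lim_seq_scal_l, is_lim_seq_geom; rewrite Rabs_pos_eq; lra. }
    apply is_lim_seq_spec in Hgeo; generalize (Hgeo eps).
    apply filter_imp; intros m Hm s Hs.
    apply Rle_lt_trans with (1 := HB m k s Hk ltac:(lra)).
    rewrite Rminus_0_r in Hm; apply Rle_lt_trans with (2 := Hm).
    apply Rle_trans with (2 := Rle_abs _).
    rewrite !(Rmult_assoc C), (Rmult_comm (exp _) ((/ 2) ^ m)).
    apply Rmult_le_compat_l; trivial; apply Rmult_le_compat_l; [apply pow_le; lra |].
    apply exp_le, Rmult_le_compat_l; [lra |].
    apply Rabs_le; lra.
  - intros m s Hs; apply continuity_pt_filterlim.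
    eapply is_derive_picard; eauto; apply HD; lra.
Qed.

Lemma system_solution_exists (n : nat) (a : R) (b : Rbar)
    (F : nat -> R -> (nat -> R) -> R) (L : R -> R) (t0 : R) (y0 : nat -> R) :
  lipschitz_field n a b F L -> open_itv a b t0 ->
  exists Y, is_system_solution n a b F Y /\ forall k, (k < n)%nat -> Y k t0 = y0 k.
Proof.
  intros HF H0.
  set (Y := picard_limit F t0 y0).
  (* [Z] is the Picard image of the limit [Y]; the aim is the fixed point equation [Y = Z] on
     (a,b). *)
  set (Z := fun k t => y0 k + RInt (fun s => F k s (fun j => Y j s)) t0 t).
  assert (HZ : forall k t, (k < n)%nat -> open_itv a b t ->
    is_derive (Z k) t (F k t (fun j => Y j t))).
  { intros k t Hk Ht.
    apply (is_derive_primitive a b (fun s => F k s (fun j => Y j s))); trivial.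
    intros s Hs; apply HF; trivial; intros j Hj.
    now apply (continuous_picard_limit n a b F L). }
  assert (HZ0 : forall k, Z k t0 = y0 k).
  { intros k; unfold Z; rewrite RInt_point; apply Rplus_0_r. }
  assert (HYZ : forall k t, (k < n)%nat -> open_itv a b t -> Y k t = Z k t).
  { intros k t Hk Ht.
    destruct (open_itv_segment a b t0 t H0 Ht) as (c & d & H0' & Ht' & HD).
    destruct (lipschitz_field_bound n a b F L c d HF HD) as (M & HM & HLM).
    destruct (picard_limit_bound n a b F L t0 y0 c d M) as (C & HC & HB);
      trivial; try lra.
    apply le_geometric_eq with (C * exp (2 * M * Rabs (t - t0))); intros m.
    (* Iterate m+1 and [Z] are the images of iterate m and [Y], so their distance is half of C/2^m
       in the weighted norm. Iterate m+1 is within C/2^(m+1) of [Y], and the two halves add up to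
       C/2^m. *)
    assert (HPZ : Rabs (picard F t0 y0 (S m) k t - Z k t)
      <= C * (/ 2) ^ m / 2 * exp (2 * M * Rabs (t - t0))).
    { apply (picard_contraction n a b F L t0 c d M _ (picard F t0 y0 m) Y
        (picard F t0 y0 (S m)) Z); auto; try lra.
      - apply Rmult_le_pos; trivial; apply pow_le; lra.
      - intros; eapply is_derive_picard; eauto.
      - intros; now rewrite HZ0, picard_init. }
    assert (HPY := HB (S m) k t Hk ltac:(lra)); fold Y in HPY.
    rewrite Rabs_minus_sym in HPY.
    replace (Y k t - Z k t) with
      ((Y k t - picard F t0 y0 (S m) k t) + (picard F t0 y0 (S m) k t - Z k t)) by ring.
    apply Rle_trans with (1 := Rabs_triang _ _).
    simpl pow in HPY; lra. }
  exists Y; split.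
  - intros k t Hk Ht.
    apply is_derive_ext_loc with (Z k); [| now apply HZ].
    generalize (open_open_itv a b t Ht); apply filter_imp.
    intros s Hs; symmetry; now apply HYZ.
  - intros k Hk; rewrite HYZ by trivial; apply HZ0.
Qed.

(** * The companion system of the conformable equation *)

Lemma continuous_sum_f_R0 (g : nat -> R -> R) (N : nat) (t : R) :
  (forall k, (k <= N)%nat -> continuous (g k) t) ->
  continuous (fun s => sum_f_R0 (fun k => g k s) N) t.
Proof.
  induction N as [| N IH]; intros Hg; simpl.
  - now apply (Hg 0%nat).
  - apply (continuous_plus (V := R_NormedModule) (fun s => sum_f_R0 (fun k => g k s) N)).
    + apply IH; intros; apply Hg; lia.
    + now apply Hg.
Qed.

(* With Y_k the k-th sequential derivative of y, T_alpha f = t^(1-alpha) f' turns the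
   equation into Y_k' = w Y_(k+1) for k + 1 < n, and Y_(n-1)' = w q - sum_j w p_j Y_j,
   where w(t) = t^(alpha-1). *)
Definition companion_field (n : nat) (w : R -> R) (p : nat -> R -> R) (q : R -> R)
    (k : nat) (t : R) (u : nat -> R) : R :=
  if Nat.ltb (S k) n then w t * u (S k)
  else w t * q t - sum_f_R0 (fun j => w t * p j t * u j) (n - 1).

(** The constant serves all rows at once: |w| controls the shift rows and the sum of the |w p_j|
    controls the last row, where the term w q cancels in differences. *)
Lemma companion_field_lipschitz (n : nat) (a : R) (b : Rbar) (w : R -> R)
    (p : nat -> R -> R) (q : R -> R) :
  (1 <= n)%nat ->
  (forall t, open_itv a b t -> continuous w t) ->
  (forall k t, (k < n)%nat -> open_itv a b t -> continuous (fun s => w s * p k s) t) ->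
  (forall t, open_itv a b t -> continuous (fun s => w s * q s) t) ->
  lipschitz_field n a b (companion_field n w p q)
    (fun t => Rabs (w t) + sum_f_R0 (fun j => Rabs (w t * p j t)) (n - 1)).
Proof.
  intros Hn Hw Hp Hq; unfold companion_field; split; [| split].
  - intros Y k t Hk Ht HY; destruct (Nat.ltb_spec (S k) n).
    + apply (continuous_mult w (Y (S k))); auto.
    + apply (continuous_minus (V := R_NormedModule) (fun s => w s * q s)); auto.
      apply (continuous_sum_f_R0 (fun j s => w s * p j s * Y j s)); intros j Hj.
      apply (continuous_mult (fun s => w s * p j s) (Y j));
        [apply Hp | apply HY]; trivial; lia.
  - intros t Ht.
    apply (continuous_plus (V := R_NormedModule) (fun s => Rabs (w s))).
    + apply (continuous_comp w Rabs); auto using continuous_Rabs.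
    + apply (continuous_sum_f_R0 (fun j s => Rabs (w s * p j s))); intros j Hj.
      apply (continuous_comp (fun s => w s * p j s) Rabs); [| apply continuous_Rabs].
      apply Hp; trivial; lia.
  - intros k t u v D Hk Ht HD Huv.
    pose proof (Rabs_pos (w t)).
    assert (HS : 0 <= sum_f_R0 (fun j => Rabs (w t * p j t)) (n - 1)).
    { apply cond_pos_sum; intros; apply Rabs_pos. }
    rewrite Rmult_plus_distr_r.
    assert (0 <= Rabs (w t) * D) by (apply Rmult_le_pos; trivial).
    assert (0 <= sum_f_R0 (fun j => Rabs (w t * p j t)) (n - 1) * D)
      by (apply Rmult_le_pos; trivial).
    destruct (Nat.ltb_spec (S k) n).
    + rewrite <- Rmult_minus_distr_l, Rabs_mult.
      assert (Rabs (w t) * Rabs (u (S k) - v (S k)) <= Rabs (w t) * D)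
        by (apply Rmult_le_compat_l; auto).
      lra.
    + replace (w t * q t - sum_f_R0 (fun j => w t * p j t * u j) (n - 1)
        - (w t * q t - sum_f_R0 (fun j => w t * p j t * v j) (n - 1)))
        with (- sum_f_R0 (fun j => w t * p j t * u j - w t * p j t * v j) (n - 1))
        by (rewrite minus_sum; ring).
      rewrite Rabs_Ropp.
      apply Rle_trans with (1 := Rsum_abs _ _).
      apply Rle_trans with (sum_f_R0 (fun j => Rabs (w t * p j t) * D) (n - 1)).
      * apply sum_Rle; intros j Hj.
        rewrite <- Rmult_minus_distr_l, Rabs_mult.
        apply Rmult_le_compat_l; [apply Rabs_pos | apply Huv; lia].
      * rewrite <- scal_sum, (Rmult_comm D).
        lra.
Qed.

Lemma ivp_solution_system (n : nat) (alpha a : R) (b : Rbar) (t0 : R)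
    (p : nat -> R -> R) (q : R -> R) (y0 : nat -> R) (y : R -> R) :
  is_ivp_solution n alpha a b t0 p q y0 y ->
  is_system_solution n a b (companion_field n (fun t => Rpower t (alpha - 1)) p q)
    (fun k => conf_deriv_n alpha k y).
Proof.
  intros (Hd & He & _) k t Hk Ht.
  pose proof (ex_conf_deriv_is_derive alpha _ t (Hd k Hk t Ht)) as H.
  replace (companion_field n (fun t => Rpower t (alpha - 1)) p q k t
    (fun j => conf_deriv_n alpha j y t))
    with (Rpower t (alpha - 1) * conf_deriv_n alpha (S k) y t); trivial.
  unfold companion_field; destruct (Nat.ltb_spec (S k) n); trivial.
  replace (S k) with n by lia.
  (* In the last row, replacing [q t] by the left side of the equation cancels the p_j terms and
     leaves w times the n-th sequential derivative. *)
  rewrite <- (He t Ht).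
  rewrite (sum_eq (fun j => Rpower t (alpha - 1) * p j t * conf_deriv_n alpha j y t)
    (fun j => p j t * conf_deriv_n alpha j y t * Rpower t (alpha - 1)))
    by (intros; ring).
  rewrite <- scal_sum; ring.
Qed.

Lemma system_ivp_solution (n : nat) (alpha a : R) (b : Rbar) (t0 : R)
    (p : nat -> R -> R) (q : R -> R) (y0 : nat -> R) (Y : nat -> R -> R) :
  (1 <= n)%nat -> open_itv a b t0 ->
  is_system_solution n a b (companion_field n (fun t => Rpower t (alpha - 1)) p q) Y ->
  (forall k, (k < n)%nat -> Y k t0 = y0 k) ->
  is_ivp_solution n alpha a b t0 p q y0 (Y 0%nat).
Proof.
  intros Hn H0 HY HY0.
  (* [Z] adds an n-th component, the value that the equation prescribes for the n-th sequential
     derivative. All rows then read Y_k' = w Z_(k+1). *)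
  set (Z := fun k t => if Nat.ltb k n then Y k t
    else q t - sum_f_R0 (fun j => p j t * Y j t) (n - 1)).
  assert (HZY : forall k t, (k < n)%nat -> Z k t = Y k t).
  { intros k t Hk; unfold Z; now rewrite (proj2 (Nat.ltb_lt k n) Hk). }
  assert (HYZ : forall k t, (k < n)%nat -> open_itv a b t ->
    is_derive (Y k) t (Rpower t (alpha - 1) * Z (S k) t)).
  { intros k t Hk Ht; specialize (HY k t Hk Ht); revert HY.
    unfold companion_field, Z; destruct (Nat.ltb_spec (S k) n); trivial.
    rewrite (sum_eq (fun j => Rpower t (alpha - 1) * p j t * Y j t)
      (fun j => p j t * Y j t * Rpower t (alpha - 1))) by (intros; ring).
    now rewrite <- scal_sum, <- Rmult_minus_distr_l. }
  (* The identity at order k is assumed on all of (a,b), since differentiating it at [t] takes a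
     neighbourhood. *)
  assert (HC : forall k t, (k < n)%nat -> open_itv a b t ->
    (forall s, open_itv a b s -> conf_deriv_n alpha k (Y 0%nat) s = Y k s) ->
    ex_conf_deriv alpha (conf_deriv_n alpha k (Y 0%nat)) t /\
    conf_deriv_n alpha (S k) (Y 0%nat) t = Z (S k) t).
  { intros k t Hk Ht Hs; apply is_derive_conf_deriv.
    apply is_derive_ext_loc with (Y k); auto.
    generalize (open_open_itv a b t Ht); apply filter_imp.
    intros s Hs'; symmetry; auto. }
  assert (HE : forall k, (k < n)%nat -> forall s, open_itv a b s ->
    conf_deriv_n alpha k (Y 0%nat) s = Y k s).
  { induction k as [| k IH]; intros Hk s Hs; trivial.
    rewrite <- HZY by trivial; apply HC; trivial; [lia | apply IH; lia]. }
  repeat split.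
  - intros k Hk t Ht; apply HC; auto.
  - intros t Ht.
    replace n with (S (n - 1)) at 1 by lia.
    rewrite (proj2 (HC (n - 1)%nat t ltac:(lia) Ht (HE (n - 1)%nat ltac:(lia)))).
    replace (S (n - 1)) with n by lia.
    unfold Z; rewrite Nat.ltb_irrefl.
    rewrite (sum_eq (fun k => p k t * conf_deriv_n alpha k (Y 0%nat) t)
      (fun k => p k t * Y k t)); [ring |].
    intros j Hj; rewrite HE; trivial; lia.
  - intros k Hk; rewrite HE; auto.
Qed.

(** * Existence and uniqueness for the initial value problem *)

Theorem theorem4p2 (n : nat) (alpha a : R) (b : Rbar) (t0 : R)
    (p : nat -> R -> R) (q : R -> R) (y0 : nat -> R)
    (hn : (1 <= n)%nat)
    (halpha : 0 < alpha <= 1)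
    (ha : 0 <= a) (hab : Rbar_lt a b)
    (ht0 : open_itv a b t0)
    (hp : forall k : nat, (k < n)%nat ->
       continuous_on (open_itv a b) (fun t => Rpower t (alpha - 1) * p k t))
    (hq : continuous_on (open_itv a b) (fun t => Rpower t (alpha - 1) * q t)) :
  (exists y : R -> R, is_ivp_solution n alpha a b t0 p q y0 y) /\
  (forall y z : R -> R,
     is_ivp_solution n alpha a b t0 p q y0 y ->
     is_ivp_solution n alpha a b t0 p q y0 z ->
     forall t : R, open_itv a b t -> y t = z t).
Proof.
  (* On an open set, continuity relative to the set is continuity at each of its points. *)
  assert (Hc : forall f : R -> R, continuous_on (open_itv a b) f ->
    forall t, open_itv a b t -> continuous f t).
  { intros f Hf t Ht; apply (continuous_continuous_on (open_itv a b)); trivial.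
    now apply open_open_itv. }
  assert (HF := companion_field_lipschitz n a b (fun t => Rpower t (alpha - 1)) p q hn).
  eassert (HF' := HF _ _ _); clear HF.
  split.
  - destruct (system_solution_exists n a b _ _ t0 y0 HF' ht0) as (Y & HY & HY0).
    exists (Y 0%nat); now apply system_ivp_solution.
  - intros y z Hy Hz t Ht.
    (* The sequential derivatives of [y] and [z] solve the same system with the same initial values;
       component 0 is the function itself. *)
    apply (system_solution_unique n a b _ _ t0 (fun k => conf_deriv_n alpha k y)
      (fun k => conf_deriv_n alpha k z) HF' ht0
      (ivp_solution_system _ _ _ _ _ _ _ _ _ Hy)
      (ivp_solution_system _ _ _ _ _ _ _ _ _ Hz)) with (k := 0%nat); trivial.
    intros k Hk; destruct Hy as (_ & _ & Hy), Hz as (_ & _ & Hz).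
    now rewrite Hy, Hz.
  Unshelve.
  (* From 0 <= a < t comes t > 0, where the logarithm inside [Rpower] is differentiable. *)
  - intros t Ht; apply (ex_derive_continuous (V := R_NormedModule)).
    destruct Ht; unfold Rpower; auto_derive; lra.
  - intros k t Hk; apply (Hc _ (hp k Hk)).
  - apply (Hc _ hq).
Qed.
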